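(* Let $a<b<c$ be pairwise coprime positive integers, and write $c=pa+qb$ with $p,q\in\mathbb{Z}$ and $0\leq q<a$. Let $Q$ be a point in the torus of $\mathbb{P}(a,b,c)$ and let $H$ be the generator of the Cartier class group of $\mathbb{P}(a,b,c)$. Then \[ \gamma_Q(H)\geq \begin{cases} (q+1)b, & \text{if } p\geq 0,\\ (a-1)b, & \text{if } p<0\text{ and }a\leq3. \end{cases} \]
   Context: Work over an arbitrary field $F$ (points are $F$-rational). $\mathbb{P}(a,b,c)$ is the weighted projective surface with coordinates $x,y,z$ of weights $a,b,c$; it is a toric surface and its torus is the open set $xyz\neq 0$. $D_x,D_y,D_z$ denote the Weil divisors defined by the vanishing of $x,y,z$. The (ample) generator $H$ of the Cartier class group satisfies $H\sim bcD_x\sim acD_y\sim abD_z$, i.e. it has weighted degree $abc$. Effective threshold: for a projective variety $X$ over $F$, an $F$-rational $\mathbb{Q}$-divisor $D$ and an $F$-rational point $Q$ of $X$, let $\pi$ be the blowup of $X$ at $Q$ and $E$ its exceptional divisor; then \[ \gamma_Q(D):=\sup\{\gamma>0\mid \pi^*(D)-\gamma E\text{ is pseudo-effective}\}. \] *)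

(* Defs.v *)
From HB Require Import structures.
From mathcomp Require Import all_boot all_order all_algebra.
From mathcomp Require Import all_classical all_reals all_analysis.
From mathcomp Require Import -(notations) mpoly.

Set Implicit Arguments.
Unset Strict Implicit.
Unset Printing Implicit Defensive.

Import Order.TTheory GRing.Theory Num.Theory.
Import numFieldNormedType.Exports.

Local Open Scope classical_set_scope.
Local Open Scope ring_scope.

(* The notations of mpoly are left out: they clash with those of
   MathComp-Analysis.  The surface P(w) is Proj F[x, y, z], the variables
   x, y, z being those of index 0, 1, 2. *)
Notation wpoly F := (mpoly.mpoly 3%N F).

Definition wt3 (a b c : nat) (i : 'I_3) : nat := nth 0%N [:: a; b; c] i.

Definition wdeg (w : 'I_3 -> nat) (m : multinom 3%N) : nat :=
  (\sum_(i < 3) w i * m i)%N.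

Fact wdeg0 (w : 'I_3 -> nat) : wdeg w (@mnm0 3%N) = 0%N.
Proof. by rewrite /wdeg big1 // => i _; rewrite mnm0E muln0. Qed.

Fact wdegD (w : 'I_3 -> nat) :
  {morph wdeg w : m1 m2 / mnm_add m1 m2 >-> (m1 + m2)%N}.
Proof.
move=> m1 m2; rewrite /wdeg -big_split /=; apply: eq_bigr => i _.
by rewrite mnmDE mulnDr.
Qed.

HB.instance Definition _ (w : 'I_3 -> nat) :=
  isMeasure.Build 3%N (wdeg w) (wdeg0 w) (wdegD w).

(* Weighted forms; the zero polynomial is a form of every degree. *)
Definition wform (F : fieldType) (w : 'I_3 -> nat) (d : nat) (f : wpoly F) : bool :=
  f \is ishomog1 d (wdeg w).

(* Cl P(w) = Z through the weighted degree.  A point of the scheme P(w) is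
   the homogeneous prime of all forms vanishing at some nonzero P in K^3, with
   K an extension field of F.  The sheaf O(d) is invertible at that point iff
   it has there a local generator, that is a quotient u / v of forms with
   deg u - deg v = d, and neither u nor v vanishing at P. *)
Definition Cartier_class (F : fieldType) (w : 'I_3 -> nat) (d : int) : Prop :=
  forall (K : fieldType) (iota : {rmorphism F -> K}) (P : 'I_3 -> K),
    (exists i, P i != 0) ->
    exists (k l : nat) (u v : wpoly F),
      [/\ wform w k u, wform w l v,
          mmap iota P u != 0, mmap iota P v != 0
        & d = k%:Z - l%:Z].

(* In Cl P(w) = Z the ample classes are those of positive degree. *)
Definition ample_Cartier_generator (F : fieldType) (w : 'I_3 -> nat) (h : int) : Prop :=
  0 < h /\ forall d : int, Cartier_class F w d <-> exists k : int, d = k * h.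

(* A point of the torus is given by homogeneous coordinates Q in (F - 0)^3;
   by Hilbert 90 every F-rational point of the torus has such coordinates. *)
Definition local_ring (F : fieldType) (w : 'I_3 -> nat) (Q : 'I_3 -> F) :
    set {fraction (wpoly F)} :=
  [set r | exists (d : nat) (u v : wpoly F),
     [/\ wform w d u, wform w d v, meval Q v != 0
       & r = FracField.tofrac u / FracField.tofrac v]].

Definition max_ideal (F : fieldType) (w : 'I_3 -> nat) (Q : 'I_3 -> F) :
    set {fraction (wpoly F)} :=
  [set r | exists (d : nat) (u v : wpoly F),
     [/\ wform w d u, wform w d v, meval Q u = 0, meval Q v != 0
       & r = FracField.tofrac u / FracField.tofrac v]].

Definition max_ideal_pow (F : fieldType) (w : 'I_3 -> nat) (Q : 'I_3 -> F) (m : nat) :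
    set {fraction (wpoly F)} :=
  [set r | exists (n : nat) (s : 'I_n -> {fraction (wpoly F)})
                  (t : 'I_n -> 'I_m -> {fraction (wpoly F)}),
     [/\ forall i, local_ring w Q (s i), forall i j, max_ideal w Q (t i j)
       & r = \sum_(i < n) s i * \prod_(j < m) t i j]].

(* The curve f = 0, with f of degree d, has multiplicity at least m at Q; it
   has local equation f / g at Q, with g any form of degree d not vanishing
   at Q. *)
Definition vanishes_to_order (F : fieldType) (w : 'I_3 -> nat) (Q : 'I_3 -> F)
    (d : nat) (f : wpoly F) (m : nat) : Prop :=
  exists g : wpoly F,
    [/\ wform w d g, meval Q g != 0
      & max_ideal_pow w Q m (FracField.tofrac f / FracField.tofrac g)].

(* N^1 of the blowup is R^2: the pair (x, y) is the class x pi^*O(1) + y E.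
   An effective Weil divisor of P(w) is the divisor div f of zeros of a nonzero
   form f, and the effective Weil divisors of the blowup are the
   pi^*(div f) - m E + k E, with k >= 0 and m at most the multiplicity of
   div f at Q. *)
Definition effective_class (R : realType) (F : fieldType) (w : 'I_3 -> nat)
    (Q : 'I_3 -> F) : set (R * R) :=
  [set v | exists (d m k : nat) (f : wpoly F),
     [/\ f != 0, wform w d f, vanishes_to_order w Q d f m
       & v = (d%:R, k%:R - m%:R)]].

Definition effective_cone (R : realType) (F : fieldType) (w : 'I_3 -> nat)
    (Q : 'I_3 -> F) : set (R * R) :=
  [set v | exists (n : nat) (t : 'I_n -> R) (e : 'I_n -> R * R),
     [/\ forall i, 0 <= t i, forall i, effective_class w Q (e i)
       & v = (\sum_(i < n) t i * (e i).1, \sum_(i < n) t i * (e i).2)]].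

Definition pseudo_effective (R : realType) (F : fieldType) (w : 'I_3 -> nat)
    (Q : 'I_3 -> F) : set (R * R) :=
  closure (effective_cone (R := R) w Q).

(* The rational D is the degree of a Q-divisor of P(w), which determines its
   numerical class.  The supremum is taken in the extended reals, where it
   exists without further proof. *)
Definition effective_threshold (R : realType) (F : fieldType) (w : 'I_3 -> nat)
    (Q : 'I_3 -> F) (D : rat) : \bar R :=
  ereal_sup [set gamma%:E | gamma in
    [set gamma : R | 0 < gamma /\ pseudo_effective w Q (ratr D, - gamma)]].

(* Main.v *)
Require Import Defs.
From HB Require Import structures.
From mathcomp Require Import all_boot all_order all_algebra.
From mathcomp Require Import all_classical all_reals all_analysis.
From mathcomp Require Import ring zify.
From mathcomp Require Import -(notations) mpoly.

Import Order.TTheory GRing.Theory Num.Theory.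
Local Open Scope ring_scope.

(** A single curve of degree [d] with multiplicity [m] at [Q] makes the class
of [pi^* H - (h m / d) E] effective, where [h] is the degree of [H]
([le_effective_threshold]); and [h >= a b c], since each weight divides [h], by
invertibility of [O(h)] at the three vertices ([le_Cartier_generator]).  So a
curve with [a c m >= t d] gives [t b] as a lower bound of the threshold.  Let
[X], [Y], [Z] be the variables rescaled so as to take the value [1] at [Q].

If [p >= 0], then [Z - X^p Y^q] has degree [c] and passes through [Q]
([binomial_curve]).  This already gives the bound [a b], and [q + 1 <= a].

If [p < 0] and [a <= 3], then [c > b] forces [a = 3] and [q = 2]: for [q = 0] the
number [c = p a] would be negative, and for [q = 1] one would have
[c = p a + b < b].  Put [k = - p], so that [c = 2 b - 3 k].  In degree
[3 c] there is the curve
[Z^3 + X^(b - 3 k) Y^3 + X^c - 3 X^(b - 2 k) Y Z], which has multiplicity at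
least [2] at [Q] ([double_point_curve]); this gives the bound [2 b].  The chart
[x != 0] is the quotient of the plane of [Y] and [Z] by the group of cube roots
of unity, and this curve is there the image of the cubic
[Y^3 + Z^3 + 1 - 3 Y Z], which is the norm form [A^3 + B^3 + C^3 - 3 A B C] with
one variable set to [1]: the product of [A + B + C] and a quadratic form in
[A - B] and [B - C], hence singular where [A = B = C].  The expansion of its
equation on the quotient itself is [double_point_expansion]. *)

(** * Lower bounds from a single curve *)

(** The hypothesis [t d <= h m] is the inequality [t <= h m / d] without
denominators: the class of the curve, scaled by [h / d], is
[(h, - h m / d)]. *)
Lemma le_effective_threshold (R : realType) (F : fieldType) (w : 'I_3 -> nat)
    (Q : 'I_3 -> F) (h t : int) (d m : nat) (f : wpoly F) :
  0 < h -> (0 < d)%N -> (0 < m)%N -> f != 0 -> wform w d f ->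
  vanishes_to_order w Q d f m -> t * d%:Z <= h * m%:Z ->
  ((t%:~R : R)%:E <= effective_threshold R w Q h%:~R)%E.
Proof.
move=> h_gt0 d_gt0 m_gt0 f_neq0 f_form f_mult le_t.
pose s : R := h%:~R / d%:R.
have d_gt0' : 0 < d%:R :> R by rewrite ltr0n.
have s_gt0 : 0 < s by rewrite divr_gt0 // ltr0z.
apply: (@le_trans _ _ (s * m%:R)%:E).
  rewrite lee_fin /s mulrAC ler_pdivlMr //.
  have := le_t; rewrite -(ler_int R) !intrM.
  by rewrite !pmulrn.
apply: ereal_sup_ubound; exists (s * m%:R) => //; split.
  by rewrite mulr_gt0 // ltr0n.
apply: subset_closure; exists 1%N, (fun=> s), (fun=> (d%:R, 0%:R - m%:R)).
split=> [_|_|]; first exact: ltW.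
  by exists d, m, 0%N, f.
by rewrite !big_ord1 /= ratr_int sub0r mulrN /s divfK ?gt_eqF.
Qed.

(** * The Cartier class group *)

(** Only the powers of the [i]-th variable survive at the [i]-th vertex, so a form
that does not vanish there contains such a power. *)
Lemma wform_vertex (F : fieldType) (w : 'I_3 -> nat) (i : 'I_3) (d : nat)
    (u : wpoly F) :
  wform w d u -> mmap idfun (fun j => (j == i)%:R) u != 0 -> (w i %| d)%N.
Proof.
move=> u_form; rewrite /mmap; apply: contraR => ndvd.
rewrite big_seq big1 //= => m m_u; rewrite /mmap1.
have [j /andP[ji mj]|no] := pickP (fun j => (j != i) && (m j != 0%N)).
  by rewrite (bigD1 j) //= (negbTE ji) expr0n (negbTE mj) mul0r mulr0.
case/negP: ndvd; rewrite -(dhomog_mf u_form m_u) /= /wdeg.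
rewrite (bigD1 i) //= big1 ?addn0 ?dvdn_mulr // => j ji.
by have := no j; rewrite ji /= => /negbFE/eqP ->; rewrite muln0.
Qed.

(** A local generator of [O(h)] at the [i]-th vertex is a quotient of two forms
whose degrees are both divisible by the [i]-th weight. *)
Lemma dvd_Cartier_class (F : fieldType) (w : 'I_3 -> nat) (h : int) (i : 'I_3) :
  Cartier_class F w h -> ((w i)%:Z %| h)%Z.
Proof.
move=> /(_ F idfun (fun j => (j == i)%:R)) [].
  by exists i; rewrite eqxx oner_neq0.
move=> k [l [u [v [u_form v_form u_neq0 v_neq0 ->]]]].
apply: rpredB; rewrite dvdzE /=.
  exact: wform_vertex u_form u_neq0.
exact: wform_vertex v_form v_neq0.
Qed.

Lemma le_Cartier_generator (F : fieldType) (a b c : nat) (h : int) :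
  coprime a b -> coprime a c -> coprime b c ->
  ample_Cartier_generator F (wt3 a b c) h -> (a * b * c)%N%:Z <= h.
Proof.
move=> coab coac cobc [h_gt0 gen].
have Ch : Cartier_class F (wt3 a b c) h by apply/gen; exists 1; rewrite mul1r.
have := dvd_Cartier_class F _ h (@Ordinal 3 0 isT) Ch.
have := dvd_Cartier_class F _ h (@Ordinal 3 1 isT) Ch.
have := dvd_Cartier_class F _ h (@Ordinal 3 2 isT) Ch.
rewrite /wt3 /= !dvdzE /= => c_h b_h a_h.
rewrite -[leRHS]gtz0_abs // lez_nat dvdn_leq ?absz_gt0 ?gt_eqF //.
by rewrite !Gauss_dvd ?coprimeMl ?coac ?a_h ?b_h.
Qed.

(** * Coordinates normalised at a point of the torus *)

Lemma wformM (F : fieldType) (w : 'I_3 -> nat) d e (f g : wpoly F) :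
  wform w d f -> wform w e g -> wform w (d + e) (f * g).
Proof. exact: dhomogM. Qed.

Lemma wformXn (F : fieldType) (w : 'I_3 -> nat) d n (f : wpoly F) :
  wform w d f -> wform w (n * d) (f ^+ n).
Proof. by move=> ?; rewrite mulnC; apply: dhomogMn. Qed.

Lemma wformD (F : fieldType) (w : 'I_3 -> nat) d (f g : wpoly F) :
  wform w d f -> wform w d g -> wform w d (f + g).
Proof. exact: rpredD. Qed.

Lemma wformB (F : fieldType) (w : 'I_3 -> nat) d (f g : wpoly F) :
  wform w d f -> wform w d g -> wform w d (f - g).
Proof. exact: rpredB. Qed.

Lemma wformMn (F : fieldType) (w : 'I_3 -> nat) d n (f : wpoly F) :
  wform w d f -> wform w d (f *+ n).
Proof. exact: rpredMn. Qed.

Definition ncoord (F : fieldType) (Q : 'I_3 -> F) (i : 'I_3) : wpoly F :=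
  (Q i)^-1 *: mpolyX F (mnm1 i).

Lemma wform_ncoord (F : fieldType) (w : 'I_3 -> nat) (Q : 'I_3 -> F) i :
  wform w (w i) (ncoord F Q i).
Proof.
rewrite /wform rpredZ // dhomogX /= /wdeg (bigD1 i) //= mnm1E eqxx muln1.
by rewrite big1 ?addn0 // => j ji; rewrite mnm1E eq_sym (negbTE ji) muln0.
Qed.

Lemma meval_ncoord (F : fieldType) (Q P : 'I_3 -> F) i :
  meval P (ncoord F Q i) = (Q i)^-1 * P i.
Proof. by rewrite mevalZ mevalXU. Qed.

Lemma meval_ncoord_self (F : fieldType) (Q : 'I_3 -> F) i :
  Q i != 0 -> meval Q (ncoord F Q i) = 1.
Proof. by move=> ?; rewrite meval_ncoord mulVf. Qed.

Lemma meval_neq0 (F : fieldType) (P : 'I_3 -> F) (f : wpoly F) :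
  meval P f != 0 -> f != 0.
Proof. by apply: contra_neq => ->; rewrite meval0. Qed.

(** * The curves *)

Lemma binomial_curve (F : fieldType) (a b c p q : nat) (Q : 'I_3 -> F) :
  (forall i, Q i != 0) -> (0 < c)%N -> c = (p * a + q * b)%N ->
  exists f : wpoly F, [/\ f != 0, wform (wt3 a b c) c f
    & vanishes_to_order (wt3 a b c) Q c f 1].
Proof.
move=> Q_torus c_gt0 c_eq; set w := wt3 a b c.
pose X := ncoord F Q (@Ordinal 3 0 isT).
pose Y := ncoord F Q (@Ordinal 3 1 isT).
pose Z := ncoord F Q (@Ordinal 3 2 isT).
have wX : wform w a X := wform_ncoord F w Q _.
have wY : wform w b Y := wform_ncoord F w Q _.
have wZ : wform w c Z := wform_ncoord F w Q _.
have QX : meval Q X = 1 by rewrite meval_ncoord_self.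
have QY : meval Q Y = 1 by rewrite meval_ncoord_self.
have QZ : meval Q Z = 1 by rewrite meval_ncoord_self.
have wf : wform w c (Z - X ^+ p * Y ^+ q).
  apply: wformB => //; rewrite c_eq.
  by apply: wformM; apply: wformXn.
exists (Z - X ^+ p * Y ^+ q); split=> //.
  (* At the vertex x = y = 0 only the power of z survives, as p and q are not
     both zero. *)
  pose P (i : 'I_3) : F := if i == 2 :> nat then 1 else 0.
  apply: (meval_neq0 F P).
  rewrite mevalB mevalM !rmorphXn /= !meval_ncoord /P /= !mulr0 mulr1.
  rewrite !expr0n -natrM mulnb.
  have -> : (p == 0%N) && (q == 0%N) = false by lia.
  by rewrite subr0 invr_neq0.
exists Z; split; rewrite ?QZ ?oner_neq0 //.
exists 1%N, (fun=> 1).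
exists (fun _ _ =>
  FracField.tofrac (Z - X ^+ p * Y ^+ q) / FracField.tofrac Z).
split=> [_|_ _|]; last by rewrite !big_ord1 mul1r.
  exists 0%N, 1, 1; split; rewrite ?rmorph1 ?divr1 ?oner_neq0 //; exact: dhomog1.
exists c, (Z - X ^+ p * Y ^+ q), Z; split; rewrite ?QZ ?oner_neq0 //.
by rewrite mevalB mevalM !rmorphXn /= QX QY QZ !expr1n mulr1 subrr.
Qed.

(** With [W = y z / (u v^2)] and [U = y^3 / (u v^3)] one has
[z^3 / (u^2 v^3) = W^3 / U], so that the left-hand side is
[W^3 / U + U + 1 - 3 W].  In [t1 = W - 1] and [t2 = U - 1] this is
[((W + 2) t1^2 - 3 t1 t2 + t2^2) / U], without terms of degree less than [2].
In [double_point_curve] one takes [u = X^(b - 3 k)] and [v = X^k], which makes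
[W] and [U] quotients of forms of equal degree, with value [1] at [Q]; the
coefficients [(W + 2) / U], [- 3 / U] and [1 / U] are written here over the common
denominator [y^3]. *)
Lemma double_point_expansion (A : comNzRingType) (K : fieldType)
    (phi : {rmorphism A -> K}) (u v y z : A) :
  phi u != 0 -> phi v != 0 -> phi y != 0 ->
  let t1 := phi (y * z - u * v ^+ 2) / phi (u * v ^+ 2) in
  let t2 := phi (y ^+ 3 - u * v ^+ 3) / phi (u * v ^+ 3) in
  phi (z ^+ 3 + u * y ^+ 3 + u ^+ 2 * v ^+ 3 - u * v * (y * z) *+ 3)
    / phi (u ^+ 2 * v ^+ 3)
  = phi ((y * z + u * v ^+ 2 *+ 2) * v) / phi (y ^+ 3) * (t1 * t1)
    + (phi (- (u * v ^+ 3 *+ 3)) / phi (y ^+ 3) * (t1 * t2)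
       + phi (u * v ^+ 3) / phi (y ^+ 3) * (t2 * t2)).
Proof.
move=> u0 v0 y0 /=.
rewrite !(rmorphXn, rmorphMn, rmorphN, rmorphB, rmorphD, rmorphM) /=.
by field; rewrite u0 v0 y0.
Qed.

(** The inequality [3 k < b], that is [b < c], ensures that all the exponents of
[X] are positive, hence also that the curve does not contain the vertex
[x = y = 0]. *)
Lemma double_point_curve (F : fieldType) (b c k : nat) (Q : 'I_3 -> F) :
  (forall i, Q i != 0) -> (3 * k < b)%N -> (c + 3 * k = 2 * b)%N ->
  exists f : wpoly F, [/\ f != 0, wform (wt3 3 b c) (3 * c) f
    & vanishes_to_order (wt3 3 b c) Q (3 * c) f 2].
Proof.
move=> Q_torus k_lt c_eq; set w := wt3 3 b c.
pose X := ncoord F Q (@Ordinal 3 0 isT).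
pose Y := ncoord F Q (@Ordinal 3 1 isT).
pose Z := ncoord F Q (@Ordinal 3 2 isT).
have wX n : wform w (n * 3) (X ^+ n) := wformXn _ _ _ _ _ (wform_ncoord F w Q _).
have wY n : wform w (n * b) (Y ^+ n) := wformXn _ _ _ _ _ (wform_ncoord F w Q _).
have wZ n : wform w (n * c) (Z ^+ n) := wformXn _ _ _ _ _ (wform_ncoord F w Q _).
have wYZ : wform w (b + c) (Y * Z).
  by apply: wformM; [have := wY 1%N | have := wZ 1%N]; rewrite mul1n.
have QX : meval Q X = 1 by rewrite meval_ncoord_self.
have QY : meval Q Y = 1 by rewrite meval_ncoord_self.
have QZ : meval Q Z = 1 by rewrite meval_ncoord_self.
pose f := Z ^+ 3 + X ^+ (b - 3 * k) * Y ^+ 3 + X ^+ c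
          - X ^+ (b - 2 * k) * (Y * Z) *+ 3.
have wf : wform w (3 * c) f.
  apply: wformB; first apply: wformD; first apply: wformD.
  - exact: wZ.
  - have -> : (3 * c = (b - 3 * k) * 3 + 3 * b)%N by lia.
    by apply: wformM.
  - by rewrite mulnC.
  - apply: wformMn; have -> : (3 * c = (b - 2 * k) * 3 + (b + c))%N by lia.
    by apply: wformM.
exists f; split=> //.
  pose P (i : 'I_3) : F := if i == 2 :> nat then 1 else 0.
  apply: (meval_neq0 F P).
  rewrite /f mevalB mevalMn !mevalD !mevalM !rmorphXn /= !meval_ncoord /P /=.
  rewrite !mulr0 mulr1 !expr0n.
  rewrite (_ : (c == 0)%N = false); last by lia.
  by rewrite /= !(mul0r, mulr0, mul0rn, addr0, subr0) !mulf_neq0 ?invr_neq0.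
pose s (i : 'I_3) : wpoly F :=
  nth 0 [:: (Y * Z + X ^+ (b - k) *+ 2) * X ^+ k; - (X ^+ b *+ 3); X ^+ b] i.
pose t1 := Y * Z - X ^+ (b - k).
pose t2 := Y ^+ 3 - X ^+ b.
pose T1 := FracField.tofrac t1 / FracField.tofrac (X ^+ (b - k)).
pose T2 := FracField.tofrac t2 / FracField.tofrac (X ^+ b).
exists (X ^+ c); split; first by rewrite mulnC.
  by rewrite rmorphXn /= QX expr1n oner_neq0.
exists 3%N, (fun i => FracField.tofrac (s i) / FracField.tofrac (Y ^+ 3)).
(* The three rows are T1 T1, T1 T2 and T2 T2: entry j of row i is at 2 i + j. *)
exists (fun i j => nth T1 [:: T1; T1; T1; T2; T2; T2] (2 * i + j)%N).
have T1_max : max_ideal w Q T1.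
  exists (b + c)%N, t1, (X ^+ (b - k)); split=> //.
  - apply: wformB => //; have -> : (b + c = (b - k) * 3)%N by lia.
    exact: wX.
  - by have -> : (b + c = (b - k) * 3)%N by lia.
  - by rewrite mevalB mevalM rmorphXn /= QX QY QZ expr1n mulr1 subrr.
  - by rewrite rmorphXn /= QX expr1n oner_neq0.
have T2_max : max_ideal w Q T2.
  exists (b * 3)%N, t2, (X ^+ b); split=> //.
  - by apply: wformB => //; rewrite mulnC.
  - by rewrite mevalB !rmorphXn /= QX QY !expr1n subrr.
  - by rewrite rmorphXn /= QX expr1n oner_neq0.
split.
- move=> i; exists (3 * b)%N, (s i), (Y ^+ 3); split=> //.
    rewrite /s; case: i => -[|[|[|//]]] _ /=.
    + have -> : (3 * b = (b + c) + k * 3)%N by lia.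
      apply: wformM => //; apply: wformD => //; apply: wformMn.
      by have -> : (b + c = (b - k) * 3)%N by lia.
    + by rewrite /wform rpredN; apply: wformMn; rewrite mulnC.
    + by rewrite mulnC.
  by rewrite rmorphXn /= QY expr1n oner_neq0.
- by move=> [[|[|[|//]]] ?] [[|[|//]] ?].
have -> : f = Z ^+ 3 + X ^+ (b - 3 * k) * Y ^+ 3
              + (X ^+ (b - 3 * k)) ^+ 2 * (X ^+ k) ^+ 3
              - X ^+ (b - 3 * k) * X ^+ k * (Y * Z) *+ 3.
  rewrite /f -!exprM -!exprD.
  by congr (_ + X ^+ _ - X ^+ _ * _ *+ 3); lia.
have Xbk : X ^+ (b - k) = X ^+ (b - 3 * k) * (X ^+ k) ^+ 2.
  by rewrite -exprM -exprD; congr (X ^+ _); lia.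
have Xb : X ^+ b = X ^+ (b - 3 * k) * (X ^+ k) ^+ 3.
  by rewrite -exprM -exprD; congr (X ^+ _); lia.
have Xc : X ^+ c = (X ^+ (b - 3 * k)) ^+ 2 * (X ^+ k) ^+ 3.
  by rewrite -!exprM -exprD; congr (X ^+ _); lia.
have X0 : X != 0 by apply: (meval_neq0 F Q); rewrite QX oner_neq0.
have Y0 : Y != 0 by apply: (meval_neq0 F Q); rewrite QY oner_neq0.
rewrite !big_ord_recl !big_ord0 /= /s /T1 /T2 /t1 /t2 /= Xbk Xb Xc.
rewrite !(addr0, mulr1).
have tofrac_neq0 (g : wpoly F) : g != 0 -> FracField.tofrac g != 0.
  by rewrite tofrac_eq0.
apply: double_point_expansion; apply: tofrac_neq0 => //; exact: expf_neq0.
Qed.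

(** * The threshold of the Cartier generator *)

Theorem proposition1p2 (R : realType) (F : fieldType) (a b c : nat) (p q : int)
    (Q : 'I_3 -> F) (H : int)
    (a_gt0 : (0 < a)%N) (ltab : (a < b)%N) (ltbc : (b < c)%N)
    (coab : coprime a b) (coac : coprime a c) (cobc : coprime b c)
    (c_eq : c%:Z = p * a%:Z + q * b%:Z) (q_ge0 : 0 <= q) (q_lta : q < a%:Z)
    (Q_torus : forall i, Q i != 0)
    (H_gen : ample_Cartier_generator F (wt3 a b c) H) :
  (0 <= p ->
     ((((q + 1) * b%:Z)%:~R : R)%:E
        <= effective_threshold R (wt3 a b c) Q H%:~R)%E) /\
  (p < 0 -> (a <= 3)%N ->
     ((((a%:Z - 1) * b%:Z)%:~R : R)%:E
        <= effective_threshold R (wt3 a b c) Q H%:~R)%E).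
Proof.
have h_ge := le_Cartier_generator F a b c H coab coac cobc H_gen.
have h_gt0 : 0 < H := H_gen.1.
split=> [p_ge0|p_lt0 a_le3].
  have [|f [f_neq0 f_form f_mult]] :=
    binomial_curve F a b c `|p|%N `|q|%N Q Q_torus
      (ltn_trans a_gt0 (ltn_trans ltab ltbc)).
    by apply/eqP; rewrite -eqz_nat PoszD !PoszM !gez0_abs // c_eq.
  apply: le_effective_threshold f_neq0 f_form f_mult _ => //; first by lia.
  rewrite mulr1; apply: le_trans h_ge; nia.
(* The values q = 0 and q = 1 would give c < 0 and c < b. *)
have [a3 q2] : a = 3%N /\ q = 2 by nia.
subst a q.
have [||f [f_neq0 f_form f_mult]] := double_point_curve F b c `|p|%N Q Q_torus.
- by lia.
- by lia.
apply: le_effective_threshold f_neq0 f_form f_mult _ => //; first by lia.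
by nia.
Qed.
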